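(* Let $p$ be an odd prime, $m,s$ positive integers, and $\mathcal{R}=\mathbb{F}_{p^m}[u,v]/\langle u^2,v^2,uv-vu\rangle$. Let $\alpha=\alpha_1+\alpha_2u+\alpha_3v+\alpha_4uv\in\mathcal{R}$ with $\alpha_1,\alpha_2,\alpha_3\in\mathbb{F}_{p^m}^*$, $\alpha_4\in\mathbb{F}_{p^m}$, and suppose $\alpha$ is not a square in $\mathcal{R}$. Let $\alpha_0\in\mathbb{F}_{p^m}$ be the element with $\alpha_0^{p^s}=\alpha_1$. Let $\mathcal{C}=\langle (x^2-\alpha_0)^\ell+u(x^2-\alpha_0)^tz(x),\ u(x^2-\alpha_0)^\mu\rangle$ be the ideal of $\mathcal{R}_\alpha=\mathcal{R}[x]/\langle x^{2p^s}-\alpha\rangle$, where $0\le\ell\le 2p^s-1$, $0\le t<\ell$, $z(x)$ is $0$ or a unit, and $0\le\mu<\Im$, where $\Im$ is the smallest non-negative integer such that $u(x^2-\alpha_0)^{\Im}\in\langle (x^2-\alpha_0)^\ell+u(x^2-\alpha_0)^tz(x)\rangle$. Then the Hamming distance of $\mathcal{C}$ is $$d_H(\mathcal{C})=\begin{cases}1 & \text{if } 0\le\mu\le p^s;\\ (\Gamma+1)p^{\gamma} & \text{if } 2p^s-p^{s-\gamma}+(\Gamma-1)p^{s-\gamma-1}+1\le\mu\le 2p^s-p^{s-\gamma}+\Gamma p^{s-\gamma-1},\\ & \text{where } 1\le\Gamma\le p-1 \text{ and } 0\le\gamma\le s-1.\end{cases}$$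
   Context: Elements of $\mathcal{R}_\alpha=\mathcal{R}[x]/\langle x^{2p^s}-\alpha\rangle$ are identified with vectors in $\mathcal{R}^{2p^s}$: the class whose representative of degree less than $2p^s$ is $\zeta_0+\zeta_1x+\cdots+\zeta_{2p^s-1}x^{2p^s-1}$ corresponds to $(\zeta_0,\ldots,\zeta_{2p^s-1})$. Ideals of $\mathcal{R}_\alpha$ are thereby the $\alpha$-constacyclic codes of length $2p^s$ over $\mathcal{R}$. The Hamming weight of a vector is the number of its nonzero entries, and the Hamming distance $d_H(\mathcal{C})$ of a nonzero linear code is the minimum Hamming weight of its nonzero codewords. When $z(x)$ is a unit, it is represented as a finite sum $z(x)=\sum_{\kappa}(z_{0\kappa}x+z_{1\kappa})(x^2-\alpha_0)^\kappa$ with $z_{0\kappa},z_{1\kappa}\in\mathbb{F}_{p^m}$ and $z_{00}x+z_{10}\ne0$. *)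

(* Defs.v *)
From HB Require Import structures.
From mathcomp Require Import all_boot all_order all_algebra all_field.
From mathcomp Require Import qpoly.

Set Implicit Arguments.
Unset Strict Implicit.
Unset Printing Implicit Defensive.

Import GRing.Theory.
Local Open Scope ring_scope.

Section BaseRing.
Variable F : fieldType.

(* F[u,v]/<u^2, v^2, uv - vu>, built as (F[u]/<u^2>)[v]/<v^2>. *)
Definition uRing := {poly %/ ('X^2 : {poly F})}.
HB.instance Definition _ := GRing.ComNzRing.on uRing.
Definition baseRing := {poly %/ ('X^2 : {poly uRing})}.
HB.instance Definition _ := GRing.ComNzRing.on baseRing.

Definition cst (a : F) : baseRing := qpolyC _ (qpolyC _ a).
Definition uR : baseRing := qpolyC _ 'qX.
Definition vR : baseRing := 'qX.

(* By baseElt_inj and baseElt_surj, 1, u, v, uv is an F-basis of baseRing. *)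
Definition baseElt (a1 a2 a3 a4 : F) : baseRing :=
  cst a1 + cst a2 * uR + cst a3 * vR + cst a4 * uR * vR.

End BaseRing.

Arguments uR {F}.
Arguments vR {F}.

Section QuotientX2.
Variable A : comNzRingType.
Let Q := {poly %/ ('X^2 : {poly A})}.

Lemma mkX2 : mk_monic ('X^2 : {poly A}) = 'X^2.
Proof. by rewrite mk_monic_Xn. Qed.

Lemma qX_polyX : ('qX : Q) = 'X :> {poly A}.
Proof. by rewrite qpolyXE ?size_polyXn ?monicXn. Qed.

Lemma qX_sqr0 : ('qX : Q) ^+ 2 = 0.
Proof.
rewrite /qpolyX -rmorphXn; apply/val_inj; rewrite /= mkX2.
exact: Pdiv.RingMonic.rmodpp (monicXn _ _).
Qed.

Lemma val_lin (a b : A) :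
  (qpolyC _ a + qpolyC _ b * 'qX : Q) = a%:P + b%:P * 'X :> {poly A}.
Proof.
rewrite poly_of_qpolyD poly_of_qpolyM qX_polyX /= mkX2.
rewrite Pdiv.CommonRing.rmodp_small // size_polyXn mul_polyC.
by rewrite (leq_ltn_trans (size_scale_leq _ _)) // size_polyX.
Qed.

Lemma coef_lin (a b : A) (i : nat) :
  (qpolyC _ a + qpolyC _ b * 'qX : Q)`_i =
    if i == 0%N then a else if i == 1%N then b else 0.
Proof.
rewrite val_lin coefD coefC coefMX coefC.
by case: i => [|[|i]] /=; rewrite ?addr0 ?add0r.
Qed.

Lemma qpolyX2E (q : Q) : q = qpolyC _ q`_0 + qpolyC _ q`_1 * 'qX.
Proof.
apply/npolyP => i; rewrite coef_lin; case: i => [|[|i]] //=.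
by rewrite nth_default // -ltnS (leq_trans (size_mk_monic q)) // mkX2 size_polyXn.
Qed.

Lemma qpolyX2_inj (a b c d : A) :
  qpolyC _ a + qpolyC _ b * 'qX = qpolyC _ c + qpolyC _ d * 'qX :> Q ->
  a = c /\ b = d.
Proof.
move=> e; split; first by move: (coef_lin a b 0); rewrite e coef_lin.
by move: (coef_lin a b 1); rewrite e coef_lin.
Qed.

End QuotientX2.

Section BaseRingTheory.
Variable F : fieldType.
Local Notation R := (baseRing F).

Lemma uR_sqr0 : (uR : R) ^+ 2 = 0.
Proof. by rewrite /uR -rmorphXn /= qX_sqr0 rmorph0. Qed.

Lemma vR_sqr0 : (vR : R) ^+ 2 = 0.
Proof. exact: qX_sqr0. Qed.

Lemma baseEltE (a1 a2 a3 a4 : F) :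
  baseElt a1 a2 a3 a4 = qpolyC _ (qpolyC _ a1 + qpolyC _ a2 * 'qX)
    + qpolyC _ (qpolyC _ a3 + qpolyC _ a4 * 'qX) * 'qX.
Proof. by rewrite /baseElt /cst /uR /vR !rmorphD !rmorphM /= mulrDl !addrA. Qed.

Lemma baseElt_inj (a1 a2 a3 a4 b1 b2 b3 b4 : F) :
  baseElt a1 a2 a3 a4 = baseElt b1 b2 b3 b4 ->
  [/\ a1 = b1, a2 = b2, a3 = b3 & a4 = b4].
Proof.
rewrite !baseEltE => /qpolyX2_inj[/qpolyX2_inj[-> ->] /qpolyX2_inj[-> ->]].
by split.
Qed.

Lemma baseElt_surj (r : R) : exists a1 a2 a3 a4 : F, r = baseElt a1 a2 a3 a4.
Proof.
exists (r`_0)`_0, (r`_0)`_1, (r`_1)`_0, (r`_1)`_1.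
by rewrite baseEltE -!qpolyX2E.
Qed.

End BaseRingTheory.

Section Codes.
Variable A : nmodType.
Variable n : nat.

Definition hamming_weight (w : 'rV[A]_n) : nat := #|[set i | w ord0 i != 0]|.

Definition is_hamming_distance (C : 'rV[A]_n -> Prop) (d : nat) : Prop :=
  (exists w, [/\ C w, w <> 0 & hamming_weight w = d]) /\
  (forall w, C w -> w <> 0 -> (d <= hamming_weight w)%N).

End Codes.

Section Constacyclic.
Variable A : comNzRingType.

Definition constaRing (n : nat) (a : A) := {poly %/ ('X^n - a%:P)}.
HB.instance Definition _ n a := GRing.ComNzRing.on (constaRing n a).
HB.instance Definition _ n a := GRing.Algebra.on (constaRing n a).

(* {poly %/ h} is the quotient by mk_monic h; here this is h itself. *)
Lemma mk_monic_consta (n : nat) (a : A) :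
  (0 < n)%N -> mk_monic ('X^n - a%:P) = 'X^n - a%:P.
Proof.
by move=> n_gt0; rewrite /mk_monic size_XnsubC // ltnS n_gt0 monicXnsubC.
Qed.

Definition word (n : nat) (a : A) (c : constaRing n a) : 'rV[A]_n :=
  \row_(i < n) (c : {poly A})`_i.

Definition code_of (n : nat) (a : A) (I : constaRing n a -> Prop) :
    'rV[A]_n -> Prop :=
  fun w => exists2 c, I c & w = word c.

End Constacyclic.

Definition ideal1 (B : comNzRingType) (g : B) : B -> Prop :=
  fun c => exists f, c = f * g.

Definition ideal2 (B : comNzRingType) (g1 g2 : B) : B -> Prop :=
  fun c => exists f1 f2, c = f1 * g1 + f2 * g2.

Definition is_least (P : nat -> Prop) (k : nat) : Prop :=
  P k /\ forall j, P j -> (k <= j)%N.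

Section CodeElements.
Variables (F : finFieldType) (n : nat) (alpha : baseRing F).
Local Notation S := (constaRing n alpha).

Definition cstS (a : F) : S := (cst a)%:A.
Definition xS : S := 'qX.
Definition uS : S := (uR : baseRing F)%:A.

Definition x2sub (a0 : F) : S := xS ^+ 2 - cstS a0.

(* A unit z is moreover one whose coefficients in powers of x^2 - a0 are
   polynomials over F of degree at most 1, with nonzero constant coefficient. *)
Definition zero_or_unit (a0 : F) (z : S) : Prop :=
  z = 0 \/
  (exists y, z * y = 1) /\
  exists (K : nat) (z0 z1 : nat -> F),
    z0 0%N *: 'X + (z1 0%N)%:P != 0 :> {poly F} /\
    z = \sum_(k < K.+1) (cstS (z0 k) * xS + cstS (z1 k)) * x2sub a0 ^+ k.

End CodeElements.

Arguments cstS {F n alpha} a.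
Arguments xS {F n alpha}.
Arguments uS {F n alpha}.
Arguments x2sub {F n alpha} a0.

(* All the subtractions are exact when the first two conditions hold. *)
Definition dist_range (p s mu Gam gam : nat) : bool :=
  [&& (1 <= Gam <= p - 1)%N, (0 <= gam <= s - 1)%N,
      (2 * p ^ s - p ^ (s - gam) + (Gam - 1) * p ^ (s - gam - 1) + 1 <= mu)%N &
      (mu <= 2 * p ^ s - p ^ (s - gam) + Gam * p ^ (s - gam - 1))%N].

(* Main.v *)
(** Put P = p^s, q = X^2 - alpha0 and y = q(x). Then u y^P = alpha3 u v, so the
    elements of R_alpha killed by u are the multiples u f(x) with f over the field,
    and, q being irreducible, they form a chain of ideals <u y^k>. Since mu is
    below the exponent at which <g> meets this chain, the part of C killed by u is
    <u y^mu>. Multiplication by u does not increase Hamming weights and sends C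
    into <u y^mu>, so d(C) = d(<u y^mu>). If mu <= P this ideal contains u v, of
    weight 1; otherwise it equals <u v y^(mu - P)>, that is, the code generated by
    q^(mu - P) over the field. Its distance is found by splitting a polynomial
    into its slices f = sum_r X^r f_r(X^k), first for k = 2 and then for k a power
    of p, down to degree < p, where a root of multiplicity n forces more than n
    nonzero coefficients. *)

From HB Require Import structures.
Require Import Defs.
From mathcomp Require Import all_boot all_order all_algebra all_field.
From mathcomp Require Import qpoly ring zify.
Set Implicit Arguments.
Unset Strict Implicit.
Unset Printing Implicit Defensive.
Import GRing.Theory.
Local Open Scope ring_scope.

(** * Weights of polynomials *)

Section PolyWeight.
Variable F : fieldType.
Implicit Types f g h : {poly F}.

Definition pweight f : nat := \sum_(i < size f) (f`_i != 0)%R.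

Lemma pweightE n f : (size f <= n)%N -> pweight f = (\sum_(i < n) (f`_i != 0)%R)%N.
Proof.
move=> le_fn; rewrite /pweight (big_ord_widen n (fun i => (f`_i != 0)%R : nat)) //.
rewrite [RHS](bigID (fun i : 'I_n => (i < size f)%N)) /= [X in (_ + X)%N]big1 ?addn0 //.
by move=> i; rewrite -leqNgt => /(nth_default 0) ->; rewrite eqxx.
Qed.

Lemma pweight_gt0 f : f != 0 -> (0 < pweight f)%N.
Proof.
move=> f_neq0; rewrite /pweight; have: lead_coef f != 0 by rewrite lead_coef_eq0.
rewrite lead_coefE; case: (size f) (size_poly_eq0 f) => [|n].
  by rewrite (negPf f_neq0).
by move=> _ /= lc; rewrite big_ord_recr /= lc addn1.
Qed.

Lemma pweight0 : pweight 0 = 0%N.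
Proof. by rewrite /pweight size_poly0 big_ord0. Qed.

Lemma pweightMX f : pweight (f * 'X) = pweight f.
Proof.
rewrite (@pweightE (size f).+1) ?(leq_trans (size_polyMleq _ _)) ?size_polyX ?addn2 //.
rewrite big_ord_recl coefMX eqxx /= add0n /pweight.
by apply: eq_bigr => i _; rewrite coefMX.
Qed.

Lemma pweight_leD f g : (pweight (f + g) <= pweight f + pweight g)%N.
Proof.
pose n := maxn (size f) (size g).
rewrite (@pweightE n (f + g)) ?size_polyD // (@pweightE n f) ?leq_maxl //.
rewrite (@pweightE n g) ?leq_maxr // -big_split leq_sum // => i _; rewrite coefD.
by case: (f`_i =P 0) => [->|]; case: (g`_i =P 0) => [->|];
   rewrite ?addr0 ?eqxx //; case: eqP.
Qed.

Lemma pweightZ_le a f : (pweight (a *: f) <= pweight f)%N.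
Proof.
rewrite (@pweightE (size f) (a *: f)) ?size_scale_leq // leq_sum // => i _.
by rewrite coefZ mulf_eq0 negb_or; case: (a == 0).
Qed.

Lemma pweight_sum_le n (G : 'I_n -> {poly F}) m :
  (forall i, pweight (G i) <= m)%N -> (pweight (\sum_i G i) <= n * m)%N.
Proof.
move=> le_m; rewrite -[X in (X * m)%N]card_ord -sum_nat_const.
elim/big_ind2: _ => [|a f b g le1 le2|i _]; rewrite ?pweight0 //.
exact: leq_trans (pweight_leD _ _) (leq_add le1 le2).
Qed.

(** Each of the at most [size f] terms of [f] contributes a scaled shift of [g]. *)
Lemma pweight_compXn_mul_le k f g :
  (pweight ((f \Po 'X^k) * g) <= size f * pweight g)%N.
Proof.
rewrite comp_polyE mulr_suml; apply: pweight_sum_le => i.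
rewrite -scalerAl (leq_trans (pweightZ_le _ _)) // -exprM mulrC.
by elim: (k * i)%N => [|n IHn]; rewrite ?expr0 ?mulr1 // exprSr mulrA pweightMX.
Qed.

Section SmallDegree.
Variables (p : nat) (pcharF : p \in [pchar F]).

(** Below degree p the integers brought down by derivation are nonzero in [F], so only the constant
    term is lost. *)
Lemma pweight_deriv f :
  (size f <= p)%N -> pweight f = ((f`_0 != 0)%R + pweight f^`())%N.
Proof.
move=> le_fp; rewrite (@pweightE (size f).+1) // big_ord_recl /=.
rewrite (@pweightE (size f) f^`()); last first.
  by rewrite (leq_trans (size_poly _ _)) // leq_pred.
congr addn; apply: eq_bigr => i _; rewrite coef_deriv.
rewrite -mulr_natr mulf_eq0 negb_or -(dvdn_pcharf pcharF) /bump /= add1n.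
have [lt_ip|le_pi] := ltnP i.+1 p; first by rewrite gtnNdvd // andbT.
by rewrite nth_default ?eqxx // (leq_trans le_fp).
Qed.

(* A factor 'X does not change the weight; when the constant coefficient is
   nonzero, differentiation lowers by one both the weight and the
   multiplicity of the root c. *)
Lemma pweight_gt_mult c k g : c != 0 -> g != 0 -> (size g <= p)%N ->
  ('X - c%:P) ^+ k %| g -> (k < pweight g)%N.
Proof.
move=> c_neq0; have [n] := ubnP (size g).
elim: n => // n IHn in g k * => lt_gn g_neq0 le_gp dvd_g.
have [g0|g0] := eqVneq g`_0 0.
  have /factor_theorem[h]: root g 0 by rewrite /root horner_coef0 g0.
  rewrite subr0 => def_g.
  have h_neq0: h != 0 by apply: contraNneq g_neq0 => h0; rewrite def_g h0 mul0r.
  rewrite def_g size_mulX // in lt_gn le_gp.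
  rewrite def_g pweightMX IHn // ?(ltnW le_gp) //.
  move: dvd_g; rewrite def_g Gauss_dvdpl // coprimep_expl //.
  by move: (coprimep_XsubC ('X - c%:P) 0); rewrite subr0 root_XsubC eq_sym c_neq0.
case: k dvd_g => [|k] dvd_g; first exact: pweight_gt0.
rewrite pweight_deriv // g0 add1n ltnS.
have /dvdpP[h def_g] := dvd_g.
apply: IHn.
- by rewrite -ltnS (leq_trans _ lt_gn) // ltnS lt_size_deriv.
(* The degree of [g] is below p, so a zero derivative makes [g] constant; having the root [c], it
   would then be zero. *)
- apply: contraNneq g0 => g'0.
  have g_const: (size g <= 1)%N.
    rewrite leqNgt; apply/negP => gt1_g; move/polyP/(_ (size g).-2): g'0.
    rewrite coef_deriv coef0 -mulr_natr prednK; last by rewrite -ltnS prednK // ltnW.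
    apply/eqP; rewrite mulf_eq0 -lead_coefE lead_coef_eq0 (negPf g_neq0) /=.
    rewrite -(dvdn_pcharf pcharF) gtnNdvd //; first by rewrite -ltnS prednK // ltnW.
    by rewrite prednK // ltnW.
  have: root g c by rewrite -dvdp_XsubCl (dvdp_trans _ dvd_g) // exprS dvdp_mulr.
  by rewrite (size1_polyC g_const) /root hornerC coefC.
- by rewrite (leq_trans _ le_gp) // ltnW // lt_size_deriv.
rewrite def_g derivM deriv_exp derivXsubC mul1r -mulr_natl mulrA.
by rewrite dvdp_addl ?dvdp_mull // exprS dvdp_mull.
Qed.
End SmallDegree.
End PolyWeight.

(** * Splitting a polynomial by the residues of its exponents modulo k *)

Section Slices.
Variables (F : fieldType) (k : nat) (k_gt0 : (0 < k)%N).
Implicit Types f g h : {poly F}.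

(** The part of [f] with exponents congruent to r modulo k, read as a polynomial in X^k after
    removing X^r; the bound [size f] suffices for every k > 0. *)
Definition slice r f : {poly F} := \poly_(j < size f) f`_(j * k + r).

Lemma coef_slice r f j : (slice r f)`_j = f`_(j * k + r).
Proof.
rewrite coef_poly; case: ltnP => // le_fj; rewrite nth_default //.
by rewrite (leq_trans le_fj) // (leq_trans (leq_pmulr j k_gt0)) ?leq_addr.
Qed.

Lemma size_slice r f m : (size f <= m * k)%N -> (size (slice r f) <= m)%N.
Proof.
move=> le_f; apply/leq_sizeP => j le_mj; rewrite coef_slice nth_default //.
by rewrite (leq_trans le_f) // (leq_trans (leq_mul le_mj (leqnn k))) ?leq_addr.
Qed.

(** Multiplying by a polynomial in X^k preserves residues of exponents, so slicing is linear over
    such polynomials. *)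
Lemma slice_comp_mul r f g : (r < k)%N ->
  slice r ((g \Po 'X^k) * f) = g * slice r f.
Proof.
move=> lt_rk; elim/poly_ind: g => [|g c IHg].
  by rewrite comp_poly0 !mul0r; apply/polyP => j; rewrite coef_slice !coef0.
rewrite comp_polyD comp_polyM comp_polyX comp_polyC !mulrDl.
rewrite [g * 'X]mulrC -[_ * 'X^k]mulrC -!mulrA -IHg; apply/polyP => j.
rewrite coef_slice !coefD !coefCM coef_slice coefXM coefXnM; congr (_ + _).
case: j => [|j] /=; first by rewrite mul0n add0n lt_rk.
rewrite coef_slice mulSn -addnA ltnNge leq_addr /=.
by rewrite addKn.
Qed.

Lemma pweight_slice f : pweight f = (\sum_(r < k) pweight (slice r f))%N.
Proof.
have le_f : (size f <= size f * k)%N by rewrite leq_pmulr.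
rewrite (pweightE le_f) -(big_mkord xpredT (fun i => (f`_i != 0)%R : nat)).
rewrite big_nat_mul big_mkord.
under eq_bigr => j _.
  rewrite -[(j * k)%N]add0n big_addn mulSn addnK big_mkord.
  over.
rewrite exchange_big; apply: eq_bigr => r _.
rewrite (@pweightE _ (size f)) ?size_slice //.
by apply: eq_bigr => j _; rewrite coef_slice addnC.
Qed.

Lemma pweight_slice_le r f : (r < k)%N -> (pweight (slice r f) <= pweight f)%N.
Proof.
by move=> lt_rk; rewrite (pweight_slice f) (bigD1 (Ordinal lt_rk)) //= leq_addr.
Qed.

Lemma slice_neq0P f : f != 0 -> exists2 r, (r < k)%N & slice r f != 0.
Proof.
(* The slice at the residue of the degree contains the leading coefficient. *)
move=> f_neq0; exists ((size f).-1 %% k)%N; first exact: ltn_pmod.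
apply: contraNneq f_neq0 => /polyP/(_ ((size f).-1 %/ k)%N).
by rewrite coef_slice coef0 -divn_eq -lead_coefE => /eqP; rewrite lead_coef_eq0.
Qed.

Lemma slice_unique r f : (r < k)%N ->
  (forall r', (r' < k)%N -> r' != r -> slice r' f = 0) ->
  f = (slice r f \Po 'X^k) * 'X^r.
Proof.
move=> lt_rk f0; apply/polyP => j; rewrite coefMXn coef_comp_poly_Xn // coef_slice.
have [eq_r|neq_r] := eqVneq (j %% k)%N r.
  have le_rj : (r <= j)%N by rewrite -eq_r leq_mod.
  have dvd_kj : (k %| j - r)%N by rewrite -eq_r {1}(divn_eq j k) addnK dvdn_mull.
  by rewrite ltnNge le_rj dvd_kj divnK // subnK.
have: f`_j = 0.
  by rewrite (divn_eq j k) -coef_slice f0 ?coef0 ?ltn_pmod.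
case: ltnP => // le_rj ->; case: ifP => // /divnK def_j.
by case/eqP: neq_r; rewrite -(subnK le_rj) -def_j modnMDl modn_small.
Qed.

End Slices.

(** * Weights of multiples of powers of X - c in characteristic p *)

Section RepeatedRoot.
Variables (F : fieldType) (p : nat) (pcharF : p \in [pchar F]).
Implicit Types (c : F) (f g h : {poly F}).

Let p_gt0 : (0 < p)%N := prime_gt0 (pcharf_prime pcharF).

Lemma exprB_pchar k g h : (g - h) ^+ (p ^ k) = g ^+ (p ^ k) - h ^+ (p ^ k).
Proof.
have pP : [pchar {poly F}].-nat (p ^ k)%N.
  have pcharP : p \in [pchar {poly F}] by rewrite pchar_poly.
  by rewrite pnatX pnatE ?pcharP // (pcharf_prime pcharF).
by rewrite exprDn_pchar // exprNn_pchar.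
Qed.

(** Frobenius turns such a power into a polynomial in X^(p^k), which passes through slices modulo
    p^k. *)
Lemma XsubC_expM (c : F) k n :
  ('X - c%:P) ^+ (n * p ^ k) = ('X - (c ^+ (p ^ k))%:P) ^+ n \Po 'X^(p ^ k).
Proof.
rewrite mulnC exprM exprB_pchar -polyC_exp (rmorphXn (comp_poly 'X^(p ^ k))) /=.
by rewrite comp_polyB comp_polyX comp_polyC.
Qed.

(* Either two slices of f are nonzero, each with more than Gam terms, or only one
   slice of ('X - c%:P) * h is; that slice then vanishes at c ^+ (p ^ k), so the
   corresponding slice of f has a root of multiplicity Gam.+1 there. *)
Lemma pweight_lower_base c k Gam h :
  let f := ('X - c%:P) ^+ (Gam * p ^ k).+1 * h in
  c != 0 -> f != 0 -> (size f <= p ^ k.+1)%N -> (Gam.+1 < pweight f)%N.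
Proof.
move=> f c_neq0 f_neq0 le_f; pose P := (p ^ k)%N.
have P_gt0 : (0 < P)%N by rewrite expn_gt0 p_gt0.
have cP_neq0 : c ^+ P != 0 by rewrite expf_neq0.
pose w := ('X - c%:P) * h.
have def_f : f = (('X - (c ^+ P)%:P) ^+ Gam \Po 'X^P) * w.
  by rewrite /f exprSr XsubC_expM mulrA.
have fE r : (r < P)%N -> slice P r f = ('X - (c ^+ P)%:P) ^+ Gam * slice P r w.
  by move=> lt_rP; rewrite def_f slice_comp_mul.
have le_fr r : (size (slice P r f) <= p)%N by rewrite size_slice // -expnS.
have wt_fr r : (r < P)%N -> slice P r f != 0 -> (Gam < pweight (slice P r f))%N.
  move=> lt_rP fr_neq0.
  by apply: (pweight_gt_mult pcharF cP_neq0) => //; rewrite fE // dvdp_mulr.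
have [r lt_rP fr_neq0] := slice_neq0P P_gt0 f_neq0.
rewrite (pweight_slice P_gt0) (bigD1 (Ordinal lt_rP)) //=.
have [/existsP[r' /andP[neq_r fr'_neq0]]|] :=
    boolP [exists r' : 'I_P, (r' != Ordinal lt_rP) && (slice P r' f != 0)].
  rewrite (bigD1 r') //= addnA (leq_trans _ (leq_addr _ _)) //.
  rewrite -[Gam.+2]addn1 leq_add ?wt_fr //.
  exact: leq_trans (wt_fr _ (ltn_ord r') fr'_neq0).
rewrite negb_exists => /forallP f0.
have def_w : w = (slice P r w \Po 'X^P) * 'X^r.
  apply: (slice_unique P_gt0 lt_rP) => r' lt_r'P neq_r'.
  move: (f0 (Ordinal lt_r'P)); rewrite negb_and negbK -val_eqE /= (negPf neq_r') /= fE //.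
  by rewrite negbK mulf_eq0 expf_eq0 polyXsubC_eq0 andbF /= => /eqP.
have root_w : root (slice P r w) (c ^+ P).
  have: root w c by rewrite rootM root_XsubC eqxx.
  rewrite {1}def_w rootM => /orP[|]; first by rewrite /root horner_comp hornerXn.
  by rewrite /root hornerXn expf_eq0 (negPf c_neq0) andbF.
rewrite (leq_trans _ (leq_addr _ _)) //.
apply: (pweight_gt_mult pcharF cP_neq0) => //; rewrite fE // exprSr dvdp_mul //.
by rewrite dvdp_XsubCl.
Qed.

(** Induction on [gam], each step multiplying the bound by p. With P = p^(gam + k + 1), a factor of
    degree (p - 1)P is a polynomial in X^P and the cofactor [w] has size at most P. A nonzero slice
    of [w] is therefore a single constant, and the matching slice of [f] has a root of multiplicity
    p - 1, hence at least p terms. *)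
Lemma pweight_lower c k gam Gam h :
  let f := ('X - c%:P) ^+ ((p ^ gam - 1) * p ^ k.+1 + Gam * p ^ k).+1 * h in
  c != 0 -> f != 0 -> (size f <= p ^ (gam + k.+1))%N ->
  (Gam.+2 * p ^ gam <= pweight f)%N.
Proof.
elim: gam => [|gam IHgam] in h * => f c_neq0 f_neq0 le_f.
  rewrite expn0 muln1; rewrite /f expn0 subnn mul0n add0n in f_neq0 le_f *.
  exact: pweight_lower_base.
set P := (p ^ (gam + k.+1))%N.
have P_gt0 : (0 < P)%N by rewrite expn_gt0 p_gt0.
pose w := ('X - c%:P) ^+ ((p ^ gam - 1) * p ^ k.+1 + Gam * p ^ k).+1 * h.
have def_f : f = (('X - (c ^+ P)%:P) ^+ p.-1 \Po 'X^P) * w.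
  have expE : ((p ^ gam.+1 - 1) * p ^ k.+1 =
               p.-1 * P + (p ^ gam - 1) * p ^ k.+1)%N.
    rewrite /P expnD mulnA -mulnDl addnBA ?expn_gt0 ?p_gt0 //.
    by rewrite -mulSnr prednK // expnS.
  by rewrite /f /w mulrA -XsubC_expM -exprD addnS addnA -expE.
have fE r : (r < P)%N -> slice P r f = ('X - (c ^+ P)%:P) ^+ p.-1 * slice P r w.
  by move=> lt_rP; rewrite def_f slice_comp_mul.
have w_neq0 : w != 0 by apply: contraNneq f_neq0 => w0; rewrite def_f w0 mulr0.
(* The monic factor uses up (p - 1)P of the available size p P. *)
have le_w : (size w <= P)%N.
  have : size f = (p.-1 * P + size w)%N.
    rewrite def_f -XsubC_expM size_monicM ?monic_exp ?monicXsubC //.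
    by rewrite size_exp_XsubC.
  by rewrite -(leq_add2l (p.-1 * P)) -mulSnr prednK // -expnS -addSn => <-.
have {IHgam} := IHgam h c_neq0 w_neq0 le_w; rewrite -/w => le_wt.
apply: leq_trans (_ : (pweight w * p <= _)%N).
  by rewrite expnS [(p * _)%N]mulnC mulnA leq_mul2r le_wt orbT.
rewrite (pweight_slice P_gt0 f) (pweight_slice P_gt0 w) big_distrl leq_sum //= => r _.
have [wr0|wr_neq0] := eqVneq (slice P r w) 0; first by rewrite wr0 pweight0.
have fr_neq0 : slice P r f != 0.
  by rewrite fE // mulf_neq0 // expf_neq0 // polyXsubC_eq0.
have le_wr : (pweight (slice P r w) <= 1)%N.
  rewrite (@pweightE _ 1) ?size_slice ?mul1n // big_ord1; exact: leq_b1.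
rewrite (leq_trans (leq_mul le_wr (leqnn p))) // mul1n -[X in (X <= _)%N](prednK p_gt0).
apply: (pweight_gt_mult pcharF (expf_neq0 P c_neq0)) => //.
  by rewrite size_slice // -expnS -addSn.
by rewrite fE // dvdp_mulr.
Qed.

End RepeatedRoot.

(** * From X - c to X^2 - c *)

Section QuadraticRoot.
Variables (F : fieldType) (p : nat) (pcharF : p \in [pchar F]).
Implicit Types (c : F) (f g h : {poly F}).

Lemma X2subE c : 'X^2 - c%:P = ('X - c%:P) \Po 'X^2.
Proof. by rewrite comp_polyB comp_polyX comp_polyC. Qed.

Lemma X2sub_pchar c k : ('X^2 - c%:P) ^+ (p ^ k) = 'X^(2 * p ^ k) - (c ^+ (p ^ k))%:P.
Proof. by rewrite (exprB_pchar pcharF) -exprM -polyC_exp. Qed.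

(** A nonzero slice of [f] modulo 2 is a multiple of the same power of X - c, within half the
    size. *)
Lemma pweight_X2sub_lower c k gam Gam h :
  let f := ('X^2 - c%:P) ^+ ((p ^ gam - 1) * p ^ k.+1 + Gam * p ^ k).+1 * h in
  c != 0 -> f != 0 -> (size f <= 2 * p ^ (gam + k.+1))%N ->
  (Gam.+2 * p ^ gam <= pweight f)%N.
Proof.
move=> f c_neq0 f_neq0 le_f.
have two_gt0 : (0 < 2)%N by [].
have [r lt_r2 fr_neq0] := slice_neq0P two_gt0 f_neq0.
apply: (leq_trans _ (pweight_slice_le two_gt0 f lt_r2)).
have def_fr : slice 2 r f =
    ('X - c%:P) ^+ ((p ^ gam - 1) * p ^ k.+1 + Gam * p ^ k).+1 * slice 2 r h.
  by rewrite /f X2subE -(rmorphXn (comp_poly 'X^2)) slice_comp_mul.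
rewrite def_fr; apply: pweight_lower => //; rewrite -def_fr //.
by rewrite size_slice // mulnC.
Qed.

(** The power is a product of a polynomial of size p^gam in X^(2p^(k+1)) and one of size Gam + 1 in
    X^(2p^k), so it has at most as many terms as the product of these sizes. *)
Lemma pweight_X2sub_upper c k gam Gam :
  (pweight (('X^2 - c%:P) ^+ ((p ^ gam - 1) * p ^ k.+1 + Gam * p ^ k))
     <= Gam.+1 * p ^ gam)%N.
Proof.
have p_gt0 := prime_gt0 (pcharf_prime pcharF).
have X2subM n j :
    ('X^2 - c%:P) ^+ (n * p ^ j) = ('X - (c ^+ (p ^ j))%:P) ^+ n \Po 'X^(2 * p ^ j).
  rewrite mulnC exprM X2sub_pchar (rmorphXn (comp_poly 'X^(2 * p ^ j))) /=.
  by rewrite comp_polyB comp_polyX comp_polyC.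
(* The extra factor 1 lets [pweight_compXn_mul_le] apply to both factors in turn. *)
rewrite exprD !X2subM -[X in _ * X]mulr1.
apply: leq_trans (pweight_compXn_mul_le _ _ _) _.
rewrite size_exp_XsubC subn1 prednK ?expn_gt0 ?p_gt0 // mulnC leq_mul2r.
apply/orP; right; apply: leq_trans (pweight_compXn_mul_le _ _ _) _.
rewrite size_exp_XsubC (@pweightE _ 1) ?size_poly1 // big_ord1 coef1 oner_neq0.
by rewrite muln1.
Qed.

End QuadraticRoot.

(** * Constacyclic words over F[u,v]/<u^2, v^2> *)

HB.instance Definition _ (F : fieldType) :=
  GRing.RMorphism.copy (@cst F) (qpolyC _ \o qpolyC _).

(** Identities of this kind are proved for variables of an arbitrary commutative ring and then
    instantiated in the quotient rings. *)
Lemma factor_uv (A : comNzRingType) (a b c d u v : A) :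
  a + b * u + c * v + d * u * v = a + u * b + v * (c + u * d).
Proof. by ring. Qed.

Lemma baseElt_factor (F : fieldType) (a b c d : F) :
  baseElt a b c d = cst a + uR * cst b + vR * (cst c + uR * cst d).
Proof. exact: factor_uv. Qed.

Lemma factor_u (A : comNzRingType) (b d u v : A) :
  0 + u * b + v * (0 + u * d) = u * (b + v * d).
Proof. by ring. Qed.

Lemma baseElt_u (F : fieldType) (b d : F) :
  baseElt 0 b 0 d = uR * (cst b + vR * cst d).
Proof. by rewrite baseElt_factor rmorph0; exact: factor_u. Qed.

Lemma baseElt0 (F : fieldType) : baseElt 0 0 0 0 = 0 :> baseRing F.
Proof. by rewrite baseElt_factor !rmorph0 !mulr0 !addr0 mulr0 addr0. Qed.

Section Ambient.
Variables (F : finFieldType) (N : nat) (alpha : baseRing F).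
Hypothesis N_gt0 : (0 < N)%N.
Local Notation S := (constaRing N alpha).
Local Notation h := ('X^N - alpha%:P).

(** Evaluation at the class of X; on sizes at most N it keeps the coefficients, by [coefS_emb]. *)
Definition emb : {poly F} -> S := in_qpoly h \o map_poly (@cst F).
HB.instance Definition _ := GRing.RMorphism.copy emb (in_qpoly h \o map_poly (@cst F)).

Definition coefS (c : S) (i : nat) : baseRing F := (c : {poly baseRing F})`_i.

Lemma coefSD c d i : coefS (c + d) i = coefS c i + coefS d i.
Proof. by rewrite /coefS /= coefD. Qed.

Lemma coefSZ (a : baseRing F) c i : coefS (a%:A * c) i = a * coefS c i.
Proof. by rewrite mulr_algl /coefS /= coefZ. Qed.

Lemma coefS_inj c d : (forall i, coefS c i = coefS d i) -> c = d.
Proof. by move=> eq_cd; apply/val_inj/polyP. Qed.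

Lemma size_consta (c : S) : (size (c : {poly baseRing F}) <= N)%N.
Proof.
by rewrite -ltnS (leq_trans (size_mk_monic c)) // mk_monic_consta // size_XnsubC.
Qed.

Lemma coefS_emb (f : {poly F}) i : (size f <= N)%N -> coefS (emb f) i = cst f`_i.
Proof.
move=> le_f; rewrite /coefS /emb /= Pdiv.CommonRing.rmodp_small ?coef_map //.
rewrite mk_monic_consta // size_XnsubC // ltnS.
by rewrite (leq_trans (size_poly _ _)).
Qed.

Lemma embC a : emb a%:P = cstS a.
Proof.
rewrite /cstS /emb /= map_polyC /= -(alg_polyC (cst a)).
by rewrite in_qpolyZ in_qpoly1.
Qed.

Lemma embX : emb 'X = xS.
Proof. by rewrite /emb /= map_polyX. Qed.

Lemma embB f g : emb (f - g) = emb f - emb g.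
Proof. exact: rmorphB. Qed.

Lemma embXn f n : emb (f ^+ n) = emb f ^+ n.
Proof. exact: rmorphXn. Qed.

Lemma emb_X2sub a0 : x2sub a0 = emb ('X^2 - a0%:P).
Proof. by rewrite rmorphB rmorphXn /= embC embX. Qed.

Lemma consta_Xn : (xS : S) ^+ N = alpha%:A.
Proof.
apply/eqP; rewrite -subr_eq0; apply/eqP.
have -> : (xS : S) ^+ N - alpha%:A = in_qpoly h h.
  rewrite [in RHS]rmorphB rmorphXn /=; congr (_ - _).
  have {2}->: alpha%:P = alpha *: 1 by rewrite alg_polyC.
  by rewrite in_qpolyZ in_qpoly1.
apply/val_inj; rewrite /= -[X in Pdiv.CommonRing.rmodp X]mk_monic_consta //.
by rewrite Pdiv.RingMonic.rmodpp // monic_mk_monic.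
Qed.

Definition vS : S := (vR : baseRing F)%:A.

Lemma coefS_uS c i : coefS (uS * c) i = uR * coefS c i.
Proof. exact: coefSZ. Qed.

Lemma coefS_vS c i : coefS (vS * c) i = vR * coefS c i.
Proof. exact: coefSZ. Qed.

Lemma uS_sqr0 : (uS : S) * uS = 0.
Proof. by rewrite -scalerAl mul1r scalerA -expr2 uR_sqr0 scale0r. Qed.

(** Coordinates in the basis 1, u, v, uv, taken coefficient by coefficient. The bounds on [a] and
    [d] let [uS_eq0] read their coefficients back from [emb]. *)
Lemma emb_decomp (c : S) : exists a b d e : {poly F},
  c = emb a + uS * emb b + vS * (emb d + uS * emb e) /\
  (size a <= N)%N /\ (size d <= N)%N.
Proof.
pose r i j k : F := (((coefS c i)`_j) : uRing F)`_k.
pose f j k := \poly_(i < N) r i j k.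
have sf j k : (size (f j k) <= N)%N by exact: size_poly.
exists (f 0%N 0%N), (f 0%N 1%N), (f 1%N 0%N), (f 1%N 1%N); split; last by split.
apply: coefS_inj => i; rewrite !coefSD coefS_vS coefSD !coefS_uS !coefS_emb //.
have [lt_iN|le_Ni] := ltnP i N; last first.
  rewrite {1}/coefS nth_default ?(leq_trans (size_consta c)) //.
  by rewrite !nth_default ?(leq_trans (sf _ _)) // rmorph0 !mulr0 ?addr0 ?mulr0 addr0.
rewrite /f !coef_poly lt_iN {1}[coefS c i]qpolyX2E.
by rewrite [(coefS c i)`_0]qpolyX2E [(coefS c i)`_1]qpolyX2E -baseEltE baseElt_factor.
Qed.

(** Multiplication by u leaves ua + uvd, and independence of u and uv forces a = d = 0. *)
Lemma uS_eq0 c : uS * c = 0 -> exists b e : {poly F}, c = uS * (emb b + vS * emb e).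
Proof.
have [a [b [d [e [-> [le_a le_d]]]]]] := emb_decomp c.
move=> uc0; exists b, e.
suff [-> ->] : a = 0 /\ d = 0 by rewrite rmorph0 !add0r mulrDr !mulrA [vS * _]mulrC.
have {}uc0 : uS * (emb a + vS * emb d) = 0.
  rewrite -{}uc0 !mulrDr !mulrA [uS * uS]uS_sqr0 [_ * vS * uS]mulrAC uS_sqr0.
  by rewrite !mul0r !addr0.
suff ad0 i : a`_i = 0 /\ d`_i = 0.
  by split; apply/polyP => i; rewrite coef0; case: (ad0 i).
have: coefS (uS * (emb a + vS * emb d)) i = 0 by rewrite uc0 /coefS coef0.
rewrite coefS_uS coefSD coefS_vS !coefS_emb // => ad.
have: baseElt 0 a`_i 0 d`_i = baseElt 0 0 0 0.
  by rewrite baseElt0 baseElt_u.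
by case/baseElt_inj.
Qed.

Lemma hamming_weight_uv (f : {poly F}) : (size f <= N)%N ->
  hamming_weight (word (uS * vS * emb f)) = pweight f.
Proof.
move=> le_f; rewrite (pweightE le_f) /hamming_weight -sum1dep_card.
rewrite [LHS]big_mkcond /=; apply: eq_bigr => i _; rewrite mxE -/(coefS _ _).
rewrite -mulrA coefS_uS coefS_vS coefS_emb //.
have -> : uR * (vR * cst f`_i) = baseElt 0 0 0 f`_i.
  by rewrite baseElt_u rmorph0 add0r.
case: (f`_i =P 0) => [->|/eqP fi_neq0]; first by rewrite baseElt0 eqxx.
case: eqP => // e0; case/eqP: fi_neq0.
by have /baseElt_inj[] : baseElt 0 0 0 f`_i = baseElt 0 0 0 0 by rewrite e0 baseElt0.
Qed.

Lemma hamming_weight_uS_le (c : S) :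
  (hamming_weight (word (uS * c)%R) <= hamming_weight (word c))%N.
Proof.
apply/subset_leq_card/subsetP => i; rewrite !inE !mxE -!/(coefS _ _) coefS_uS.
by apply: contraNneq => ->; rewrite mulr0.
Qed.

Lemma word0 : word (0 : S) = 0.
Proof. by apply/rowP => i; rewrite !mxE coef0. Qed.

End Ambient.

Arguments emb {F N alpha} f.
Arguments vS {F N alpha}.

(** * The chain of ideals killed by u *)

Section ChainIdeal.
Variables (F : fieldType) (A : comNzRingType) (emb : {rmorphism {poly F} -> A}).
Variables (u v : A) (q : {poly F}) (P : nat) (b : F).
Hypotheses (uu0 : u * u = 0) (vv0 : v * v = 0) (b_neq0 : b != 0).
Hypothesis q_irr : irreducible_poly q.
Local Notation y := (emb q).
Hypothesis uyP : u * y ^+ P = emb b%:P * (u * v).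
Hypothesis u_ann : forall c, u * c = 0 ->
  exists f1 f2 : {poly F}, c = u * (emb f1 + v * emb f2).

Lemma uvyP_eq0 : u * v * y ^+ P = 0.
Proof. by rewrite mulrAC uyP -!mulrA vv0 !mulr0. Qed.

(** Inverting [b] in [uyP] absorbs v into a power of q; the elements killed by u can then be written
    without v. *)
Lemma uv_emb : u * v = u * emb (b^-1 *: q ^+ P).
Proof.
rewrite -mul_polyC rmorphM rmorphXn mulrCA uyP.
by rewrite [RHS]mulrA -rmorphM -polyCM mulVf // rmorph1 mul1r.
Qed.

Lemma uy_nilpotent : u * y ^+ (P + P) = 0.
Proof. by rewrite exprD mulrA uyP -mulrA uvyP_eq0 mulr0. Qed.

Lemma ann_u_emb c : u * c = 0 -> exists f, c = u * emb f.
Proof.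
move=> /u_ann[f1 [f2 ->]]; exists (f1 + b^-1 *: q ^+ P * f2).
by rewrite mulrDr rmorphD mulrDr rmorphM !mulrA uv_emb.
Qed.

Lemma u_mul_emb c : exists f, u * c = u * emb f.
Proof. by apply: ann_u_emb; rewrite mulrA uu0 mul0r. Qed.

Section Ideal.
Variables (l t mu Im : nat) (z : A).
Local Notation g := (y ^+ l + u * y ^+ t * z).
Hypothesis ImP : is_least (fun k => ideal1 g (u * y ^+ k)) Im.
Hypothesis lt_mu : (mu < Im)%N.

(** Since u^2 = 0, u g = u y^l lies in <g>, so Im is at most l. *)
Lemma ideal_exponent_lt : (mu < l)%N.
Proof.
apply: leq_trans lt_mu _; apply: (proj2 ImP); exists u.
by rewrite mulrDr !mulrA uu0 !mul0r addr0.
Qed.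

Lemma ideal2_mul_u c : ideal2 g (u * y ^+ mu) c ->
  exists h, u * c = u * y ^+ mu * h.
Proof.
case=> f1 [f2 ->]; exists (f1 * y ^+ (l - mu)).
transitivity (u * f1 * y ^+ l); first by ring: uu0.
by rewrite -{1}(subnKC (ltnW ideal_exponent_lt)) exprD; ring.
Qed.

(* If q does not divide f, then f is invertible modulo the powers of q, so that
   u * emb (q ^+ k * f) and u * y ^+ k generate the same ideal; the minimality
   of Im then keeps the elements of <g> killed by u inside <u * y ^+ mu>. *)
Lemma ideal2_ann_u c : ideal2 g (u * y ^+ mu) c -> u * c = 0 ->
  exists h, c = u * y ^+ mu * h.
Proof.
case=> f1 [f2 ->] uc0.
(* The second generator is killed by u, so u c = u f1 g. *)
have ud0 : u * (f1 * g) = 0.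
  have e : u * (f1 * g + f2 * (u * y ^+ mu)) = u * (f1 * g) by ring: uu0.
  by rewrite -e.
have [f def_d] := ann_u_emb ud0.
have dvd_f k : (k <= mu)%N -> q ^+ k %| f.
  elim: k => [|k IHk] lt_k; first by rewrite dvd1p.
  have /dvdpP[f' def_f] := IHk (ltnW lt_k).
  rewrite def_f exprS dvdp_mul2r ?expf_neq0 ?irredp_neq0 //.
  apply: contraLR lt_k; rewrite -irreducible_poly_coprime // => cop.
  rewrite -leqNgt (leq_trans (ltnW lt_mu)) //; apply: (proj2 ImP).
  (* Here [f'] is inverted modulo q^(2P), and u y^(2P) = 0; hence [emb a2 * f1] carries g to u
     y^k. *)
  have /Bezout_eq1_coprimepP[[a1 a2] /= a12] : coprimep (q ^+ (P + P)) f'.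
    by rewrite coprimep_expl.
  exists (emb a2 * f1).
  have -> : u * y ^+ k = u * y ^+ k * emb (a1 * q ^+ (P + P) + a2 * f').
    by rewrite a12 rmorph1 mulr1.
  rewrite -[RHS]mulrA def_d def_f rmorphD !rmorphM !rmorphXn /=.
  transitivity (u * y ^+ (P + P) * (y ^+ k * emb a1) + u * y ^+ k * emb a2 * emb f').
    by ring.
  by rewrite uy_nilpotent; ring.
have /dvdpP[f' def_f] := dvd_f mu (leqnn _).
exists (emb f' + f2); rewrite def_d def_f rmorphM rmorphXn.
by rewrite mulrDr; congr (_ + _); ring.
Qed.

End Ideal.

(** Up to the unit b, uv q^e is u y^(P + e), a multiple of u y^mu. *)
Lemma uv_emb_exp_ideal e mu : (mu <= P + e)%N ->
  exists f, u * v * emb (q ^+ e) = f * (u * y ^+ mu).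
Proof.
move=> le_mu; exists (emb b^-1%:P * y ^+ (P + e - mu)).
transitivity (emb b^-1%:P * u * y ^+ (P + e)).
  by rewrite uv_emb -mul_polyC rmorphM !rmorphXn exprD; ring.
by rewrite -{1}(subnK le_mu) exprD; ring.
Qed.

(** If u h = u f, the element is uv q^i (b f). As uv y^P = 0, b f may be reduced modulo q^(P - i),
    which gives the size bound under which weights can be read off a polynomial. *)
Lemma uyP_mul_emb i h : (i <= P)%N -> q \is monic ->
  exists f : {poly F}, (size (q ^+ i * f)%R < size (q ^+ P)%R)%N /\
    u * y ^+ (P + i) * h = u * v * emb (q ^+ i * f).
Proof.
move=> le_iP q_monic; have [f def_uh] := u_mul_emb h.
pose f1 := b *: f %% q ^+ (P - i); exists f1; split.
  have q_exp_neq0 k : q ^+ k != 0 by rewrite expf_neq0 ?monic_neq0.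
  have [->|f1_neq0] := eqVneq f1 0; first by rewrite mulr0 size_poly0 size_poly_gt0.
  have : (size f1 < size (q ^+ (P - i)))%N by rewrite ltn_modp.
  rewrite -[P in X in _ -> X](subnKC le_iP) exprD !size_monicM ?monic_exp //.
  have : (0 < size (q ^+ i))%N by rewrite size_poly_gt0.
  by case: (size (q ^+ i)) => // n _; rewrite !addSn ltn_add2l.
have def_f : b *: f = b *: f %/ q ^+ (P - i) * q ^+ (P - i) + f1 by exact: divp_eq.
transitivity (u * v * (y ^+ i * emb (b *: f))).
  rewrite -mul_polyC rmorphM exprD.
  transitivity (u * h * (y ^+ P * y ^+ i)); first by ring.
  rewrite def_uh; transitivity (u * y ^+ P * (y ^+ i * emb f)); first by ring.
  by rewrite uyP; ring.
rewrite def_f rmorphD !rmorphM !rmorphXn /=.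
set e := emb (_ %/ _); have : u * v * (y ^+ i * y ^+ (P - i)) = 0.
  by rewrite -exprD subnKC // uvyP_eq0.
by move=> uv0; rewrite mulrDr mulrCA !mulrDr; ring: uv0.
Qed.

End ChainIdeal.

(** * The distance *)

Lemma sqr_uv (F A : comNzRingType) (f : {rmorphism F -> A}) (a b c d : F) (u v : A) :
  u ^+ 2 = 0 -> v ^+ 2 = 0 ->
  f (a ^+ 2) + f (2 * a * b) * u + f (2 * a * c) * v + f (2 * a * d + 2 * b * c) * u * v =
    (f a + f b * u + f c * v + f d * u * v) ^+ 2.
Proof. by move=> u2 v2; rewrite !(rmorphD, rmorphM, rmorphXn, rmorph_nat); ring: u2 v2. Qed.

Lemma baseElt_sqr (F : fieldType) (a b c d : F) :
  baseElt (a ^+ 2) (2 * a * b) (2 * a * c) (2 * a * d + 2 * b * c) = baseElt a b c d ^+ 2.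
Proof. exact: (sqr_uv (@cst F) _ _ _ _ (uR_sqr0 F) (vR_sqr0 F)). Qed.

(** A root a of the quadratic gives the square root a^n of a1, which lifts to a square root of the
    whole element. *)
Lemma nsq_X2sub_irreducible (F : fieldType) (a1 a2 a3 a4 a0 : F) n :
  2 != 0 :> F -> a1 != 0 -> a0 ^+ n = a1 ->
  ~ (exists b : baseRing F, baseElt a1 a2 a3 a4 = b ^+ 2) ->
  irreducible_poly ('X^2 - a0%:P).
Proof.
move=> n2 a1_neq0 a0n nsq; apply: cubic_irreducible => [|a].
  by rewrite size_XnsubC.
apply/negP; rewrite /root !hornerE ?hornerXn subr_eq0 => /eqP a_sqr.
apply: nsq; pose b := a ^+ n.
have b_sqr : a1 = b ^+ 2 by rewrite -exprM mulnC exprM a_sqr.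
have b_neq0 : b != 0.
  by apply: contraNneq a1_neq0 => b0; rewrite b_sqr b0 expr0n.
(* The coordinates of the square root are solved one after another, each by a division by 2b. *)
pose b2 := a2 / (2 * b); pose b3 := a3 / (2 * b).
pose b4 := (a4 - 2 * b2 * b3) / (2 * b).
exists (baseElt b b2 b3 b4); rewrite -baseElt_sqr -b_sqr.
have <- : a2 = 2 * b * b2 by rewrite /b2; field; rewrite b_neq0.
have <- : a3 = 2 * b * b3 by rewrite /b3; field; rewrite b_neq0.
by have <- : a4 = 2 * b * b4 + 2 * b2 * b3 by rewrite /b4; field; rewrite b_neq0.
Qed.

Section Constacyclic.
Variables (p s : nat) (F : finFieldType).
Hypotheses (pcharF : p \in [pchar F]) (p_odd : odd p).
Variables (alpha1 alpha2 alpha3 alpha4 alpha0 : F) (alpha : baseRing F).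
Hypotheses (alpha1_neq0 : alpha1 != 0) (alpha3_neq0 : alpha3 != 0).
Hypothesis alphaE : alpha = baseElt alpha1 alpha2 alpha3 alpha4.
Hypothesis alpha_nsq : ~ exists b : baseRing F, alpha = b ^+ 2.
Hypothesis alpha0E : alpha0 ^+ (p ^ s) = alpha1.

Local Notation P := (p ^ s)%N.
Local Notation N := (2 * P)%N.
Local Notation S := (constaRing N alpha).
Local Notation q := ('X^2 - alpha0%:P : {poly F}).
Local Notation y := (x2sub alpha0 : S).

Let p_gt0 : (0 < p)%N := prime_gt0 (pcharf_prime pcharF).
Let P_gt0 : (0 < P)%N. Proof. by rewrite expn_gt0 p_gt0. Qed.
Let N_gt0 : (0 < N)%N. Proof. by rewrite muln_gt0. Qed.

Lemma alpha0_neq0 : alpha0 != 0.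
Proof.
by apply: contraNneq alpha1_neq0 => a0; rewrite -alpha0E a0 expr0n gtn_eqF.
Qed.

Lemma X2sub_irreducible : irreducible_poly q.
Proof.
apply: (@nsq_X2sub_irreducible _ alpha1 alpha2 alpha3 alpha4 _ P) => //; last first.
  by rewrite -alphaE.
rewrite -(dvdn_pcharf pcharF) dvdn_prime2 ?(pcharf_prime pcharF) //.
by apply: contraTneq p_odd => ->.
Qed.

Lemma vS_vS : (vS : S) * vS = 0.
Proof. by rewrite -scalerAl mul1r scalerA -expr2 vR_sqr0 scale0r. Qed.

Lemma mul_u_tail (A : comNzRingType) (u v b c d : A) :
  u * u = 0 -> u * (b * u + c * v + d * u * v) = c * (u * v).
Proof. by move=> uu0; ring: uu0. Qed.

Lemma sub_const_uv (B A : comNzRingType) (f : {rmorphism B -> A}) (a b c d u v : B) :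
  f (a + b * u + c * v + d * u * v) - f a = f b * f u + f c * f v + f d * f u * f v.
Proof. by rewrite !(rmorphD, rmorphM); ring. Qed.

(** By Frobenius y^P = x^(2P) - alpha0^P, which is alpha - alpha1 in the quotient. *)
Lemma x2sub_expP :
  y ^+ P = cstS alpha2 * uS + cstS alpha3 * vS + cstS alpha4 * uS * vS.
Proof.
rewrite emb_X2sub -embXn X2sub_pchar // alpha0E embB embXn embX embC consta_Xn //.
rewrite [LHS](congr1 (fun a : baseRing F => a%:A - cstS alpha1 : S) alphaE).
exact: (sub_const_uv (in_alg S)).
Qed.

Lemma uS_x2sub_expP : uS * emb q ^+ P = emb alpha3%:P * (uS * vS) :> S.
Proof.
by rewrite -emb_X2sub x2sub_expP embC; apply: mul_u_tail; exact: uS_sqr0.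
Qed.

Definition embS : {rmorphism {poly F} -> S} := emb.

Section Code.
Variables (l t mu Im : nat) (z : S).
Local Notation g := (embS q ^+ l + uS * embS q ^+ t * z).
Hypothesis ImP : is_least (fun k => ideal1 g (uS * embS q ^+ k)) Im.
Hypothesis lt_mu : (mu < Im)%N.

(** Either u c = 0 and c itself lies in <u y^mu>, or u c is a nonzero element of it whose weight is
    no larger. *)
Lemma ideal2_reduce (c : S) : ideal2 g (uS * embS q ^+ mu) c -> c <> 0 ->
  exists h, uS * embS q ^+ mu * h <> 0 /\
    (hamming_weight (word (uS * embS q ^+ mu * h)%R) <= hamming_weight (word c))%N.
Proof.
move=> Cc c_neq0; have [uc0|/eqP uc_neq0] := eqVneq (uS * c) 0.
  have [h def_c] := ideal2_ann_u (uS_sqr0 N alpha) vS_vS alpha3_neq0 X2sub_irreducible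
    uS_x2sub_expP (@uS_eq0 F N alpha N_gt0) ImP lt_mu Cc uc0.
  by exists h; rewrite -def_c.
have [h def_uc] := ideal2_mul_u (uS_sqr0 N alpha) ImP lt_mu Cc.
exists h; move: uc_neq0 (hamming_weight_uS_le c); rewrite def_uc; by split.
Qed.

Lemma size_X2sub_exp n : size (q ^+ n) = (2 * n).+1.
Proof.
have q_exp_neq0 : q ^+ n != 0 by rewrite expf_neq0 ?monic_neq0 ?monicXnsubC.
by rewrite -(prednK (_ : 0 < size (q ^+ n))%N) ?size_exp ?size_XnsubC ?size_poly_gt0.
Qed.

(** Transfers the lower bound to multiples of q^(mu - P) over the field, of size at most N. *)
Lemma ideal2_weight_lower (c : S) : (P <= mu <= P + P)%N ->
  ideal2 g (uS * embS q ^+ mu) c -> c <> 0 ->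
  exists f : {poly F}, [/\ q ^+ (mu - P) * f != 0, (size (q ^+ (mu - P) * f)%R <= N)%N &
    (pweight (q ^+ (mu - P) * f)%R <= hamming_weight (word c))%N].
Proof.
case/andP=> le_Pmu le_mu Cc c_neq0; have [h [w_neq0 le_w]] := ideal2_reduce Cc c_neq0.
have le_iP : (mu - P <= P)%N by rewrite leq_subLR.
have q_monic : q \is monic by rewrite monicXnsubC.
have [f [lt_f def_w]] := uyP_mul_emb (uS_sqr0 N alpha) vS_vS alpha3_neq0
  uS_x2sub_expP (@uS_eq0 F N alpha N_gt0) h le_iP q_monic.
have {}lt_f : (size (q ^+ (mu - P) * f)%R <= N)%N by rewrite -ltnS -size_X2sub_exp.
rewrite subnKC // in def_w; exists f; split=> //.
  by apply/eqP => f0; apply: w_neq0; rewrite def_w f0 rmorph0 mulr0.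
by rewrite -(hamming_weight_uv alpha N_gt0 lt_f) -def_w.
Qed.

Lemma hamming_weight_gt0 (w : 'rV[baseRing F]_N) : w <> 0 -> (0 < hamming_weight w)%N.
Proof.
move=> /eqP/rV0Pn[i wi_neq0]; rewrite card_gt0; apply/set0Pn.
by exists i; rewrite inE.
Qed.

(** The word is uv q^e; e < P keeps the degree of q^e below N, so no reduction alters its terms. *)
Lemma code_weight_upper e : (e < P)%N -> (mu <= P + e)%N ->
  exists w, [/\ code_of (ideal2 g (uS * embS q ^+ mu)) w, w <> 0 &
    hamming_weight w = pweight (q ^+ e)].
Proof.
move=> lt_eP le_mu.
have [f def_c] := uv_emb_exp_ideal alpha3_neq0 uS_x2sub_expP le_mu.
have le_q : (size (q ^+ e) <= N)%N by rewrite size_X2sub_exp ltn_pmul2l.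
have wt := hamming_weight_uv alpha N_gt0 le_q.
exists (word (uS * vS * emb (q ^+ e) : S)); split=> //.
  exists (uS * vS * embS (q ^+ e)) => //.
  by exists 0, f; rewrite mul0r add0r; exact: def_c.
move=> w0; have : (0 < pweight (q ^+ e))%N.
  by rewrite pweight_gt0 // -size_poly_gt0 size_X2sub_exp.
rewrite -wt w0 /hamming_weight card_gt0 => /set0Pn[i].
by rewrite inE mxE eqxx.
Qed.

End Code.

End Constacyclic.

(** * Arithmetic of the ranges of mu *)

(** With k = s - gam - 1, the offset p^s - p^(s - gam) + Gam p^k becomes (p^gam - 1)p^(k+1) + Gam
    p^k, the exponent of the weight bounds. *)
Lemma dist_rangeP p s mu Gam gam : (0 < p)%N -> (0 < s)%N -> dist_range p s mu Gam gam ->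
  exists k, [/\ s = (gam + k.+1)%N, (0 < Gam)%N,
    ((p ^ gam - 1) * p ^ k.+1 + Gam.-1 * p ^ k < mu - p ^ s)%N,
    (mu <= p ^ s + ((p ^ gam - 1) * p ^ k.+1 + Gam * p ^ k))%N &
    ((p ^ gam - 1) * p ^ k.+1 + Gam * p ^ k < p ^ s)%N].
Proof.
move=> p_gt0 s_gt0 /and4P[/andP[Gam_gt0 le_Gam] /andP[_ le_gam] le_mu mu_le].
have lt_gam : (gam < s)%N by rewrite -(prednK s_gt0) ltnS -subn1.
exists (s - gam.+1)%N.
have def_k : (s - gam)%N = (s - gam.+1).+1 by rewrite subnSK.
have def_k1 : (s - gam - 1)%N = (s - gam.+1)%N by rewrite -subnDA addn1.
have def_s : s = (gam + (s - gam.+1).+1)%N by rewrite -def_k subnKC // ltnW.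
move: le_mu mu_le; rewrite def_k1 def_k; move: (s - gam.+1)%N def_s => k def_s.
rewrite !subn1 in le_Gam *.
have -> : (p ^ s = p ^ gam * p ^ k.+1)%N by rewrite def_s expnD.
have lt_GamQ : (Gam * p ^ k < p ^ k.+1)%N.
  by rewrite expnS ltn_pmul2r ?expn_gt0 ?p_gt0 // -(prednK p_gt0).
have le_Q : (p ^ k.+1 <= p ^ gam * p ^ k.+1)%N by rewrite leq_pmull // expn_gt0 p_gt0.
have def_B : ((p ^ gam).-1 * p ^ k.+1 = p ^ gam * p ^ k.+1 - p ^ k.+1)%N.
  by rewrite -subn1 mulnBl mul1n.
rewrite def_B; move: lt_GamQ le_Q.
move: (p ^ gam * p ^ k.+1)%N (p ^ k.+1)%N (Gam * p ^ k)%N (Gam.-1 * p ^ k)%N.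
move=> X Y Z W lt_ZY le_YX le_mu mu_le; split=> //; lia.
Qed.

Lemma dist_range_exists p s mu : (1 < p)%N -> (0 < s)%N ->
  (p ^ s < mu < 2 * p ^ s)%N -> exists Gam gam, dist_range p s mu Gam gam.
Proof.
move=> p_gt1 s_gt0 /andP[lt_mu mu_lt].
pose j := (2 * p ^ s - mu)%N.
have j_gt0 : (0 < j)%N by rewrite subn_gt0.
have lt_j : (j < p ^ s)%N by rewrite /j; lia.
have /andP[le_kj lt_jk] := trunc_log_bounds p_gt1 j_gt0.
set k := trunc_log p j in le_kj lt_jk.
have lt_ks : (k < s)%N by rewrite -(ltn_exp2l _ _ p_gt1) (leq_ltn_trans le_kj).
have Q_gt0 : (0 < p ^ k)%N by rewrite expn_gt0 ltnW.
pose D := (j %/ p ^ k)%N.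
have D_gt0 : (0 < D)%N by rewrite divn_gt0.
have lt_Dp : (D < p)%N by rewrite ltn_divLR // -expnS.
have le_DQ : (D * p ^ k <= j)%N by exact: leq_divM.
have lt_DQ : (j < D.+1 * p ^ k)%N by rewrite -ltn_divLR.
(* Here D is the leading base p digit of j = 2p^s - mu, at position k. For this choice the range
   says D p^k <= j < (D + 1)p^k. *)
exists (p - D)%N, (s - k.+1)%N; rewrite /dist_range.
have -> : (s - (s - k.+1) = k.+1)%N by rewrite subKn.
have -> : (k.+1 - 1 = k)%N by rewrite subn1.
have -> : ((p - D - 1) * p ^ k = p * p ^ k - D.+1 * p ^ k)%N by rewrite -mulnBl subn1 subnS.
rewrite mulnBl expnS.
have le1 : (D.+1 * p ^ k <= p * p ^ k)%N by rewrite leq_mul2r lt_Dp orbT.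
have le2 : (p * p ^ k <= p ^ s)%N by rewrite -expnS leq_pexp2l // ltnW.
move: le_DQ lt_DQ le1 le2 lt_mu mu_lt; rewrite /j.
move: (p * p ^ k)%N (D.+1 * p ^ k)%N (D * p ^ k)%N (p ^ s)%N => X Y Z W *.
apply/and4P; split; lia.
Qed.

Theorem theorem4p4 (p m s : nat) (F : finFieldType)
    (hp : prime p) (hodd : odd p) (hm : (0 < m)%N) (hs : (0 < s)%N)
    (hF : #|F| = (p ^ m)%N)
    (alpha1 alpha2 alpha3 alpha4 alpha0 : F)
    (h1 : alpha1 != 0) (h2 : alpha2 != 0) (h3 : alpha3 != 0)
    (alpha : baseRing F)
    (halpha : alpha = baseElt alpha1 alpha2 alpha3 alpha4)
    (hns : ~ exists b : baseRing F, alpha = b ^+ 2)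
    (h0 : alpha0 ^+ (p ^ s) = alpha1)
    (l t mu Im : nat) (z : constaRing (2 * p ^ s) alpha)
    (hl : (0 <= l <= 2 * p ^ s - 1)%N) (ht : (0 <= t < l)%N)
    (hz : zero_or_unit alpha0 z)
    (hIm : is_least
             (fun k => ideal1 (x2sub alpha0 ^+ l + uS * x2sub alpha0 ^+ t * z)
                              (uS * x2sub alpha0 ^+ k)) Im)
    (hmu : (0 <= mu < Im)%N) :
  let C := code_of (ideal2 (x2sub alpha0 ^+ l + uS * x2sub alpha0 ^+ t * z)
                           (uS * x2sub alpha0 ^+ mu)) in
  [/\ (0 <= mu <= p ^ s)%N -> is_hamming_distance C 1,
      forall Gam gam : nat, dist_range p s mu Gam gam ->
        is_hamming_distance C ((Gam + 1) * p ^ gam)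
    & (p ^ s < mu)%N -> exists Gam gam : nat, dist_range p s mu Gam gam].
Proof.
have pcharF : p \in [pchar F] := card_finPcharP hF hp.
have p_gt0 := prime_gt0 hp.
rewrite !emb_X2sub /= in hIm *.
set C := code_of _; move: (hmu) => /= lt_mu.
have lt_mul := ideal_exponent_lt (uS_sqr0 _ _) hIm lt_mu.
(* From mu < l <= 2p^s - 1. *)
have lt_muN : (mu < 2 * p ^ s)%N by case/andP: hl; lia.
split=> [/= le_mu|Gam gam /(dist_rangeP p_gt0 hs)[k [def_s Gam_gt0 lower upper lt_e]]|lt_P].
- split; last by move=> w _ /hamming_weight_gt0.
  have P_gt0 : (0 < p ^ s)%N by rewrite expn_gt0 p_gt0.
  have le_mu0 : (mu <= p ^ s + 0)%N by rewrite addn0.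
  (* With e = 0 the word is uv itself, of weight 1. *)
  have [w [Cw w_neq0 wt_w]] := code_weight_upper pcharF h3 halpha h0 l t z P_gt0 le_mu0.
  exists w; split=> //; rewrite wt_w expr0 (@pweightE _ 1) ?size_poly1 //.
  by rewrite big_ord1 coef1 oner_neq0.
- have lower_bound w : C w -> w <> 0 -> ((Gam + 1) * p ^ gam <= hamming_weight w)%N.
    case=> c Cc -> wc_neq0.
    have c_neq0 : c <> 0 by move=> c0; apply: wc_neq0; rewrite c0 word0.
    have mu_range : (p ^ s <= mu <= p ^ s + p ^ s)%N.
      rewrite addnn -mul2n (ltnW lt_muN) andbT ltnW // -subn_gt0.
      exact: leq_ltn_trans lower.
    have [f [f_neq0 le_f le_wt]] := ideal2_weight_lower pcharF hodd h1 h3 halpha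
      hns h0 hIm lt_mu mu_range Cc c_neq0.
    (* The exponent mu - p^s exceeds the offset for Gam - 1, so the weight bound is applied there;
       its (Gam - 1) + 2 is Gam + 1. *)
    apply: leq_trans le_wt; rewrite addn1 -[in Gam.+1](prednK Gam_gt0).
    move: f_neq0 le_f; rewrite -(subnKC lower) exprD -mulrA def_s => f_neq0 le_f.
    by apply: (pweight_X2sub_lower pcharF) => //; exact: (alpha0_neq0 pcharF h1 h0).
  split=> //; have [w [Cw w_neq0 wt_w]] :=
    code_weight_upper pcharF h3 halpha h0 l t z lt_e upper.
  (* The weight of this codeword is pinched between the upper bound for q^e and the lower bound for
     the code. *)
  exists w; split=> //; apply/eqP; rewrite eqn_leq lower_bound // wt_w addn1 andbT.
  exact: pweight_X2sub_upper.
by apply: dist_range_exists => //; [exact: prime_gt1 | rewrite lt_P].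
Qed.
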